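(* Suppose $G,H$ are in $\overrightarrow{\mathfrak D}$ and $u\in G$ and $v\in H$ are order-units. Then $S(G,u)\cong S(H,v)$ if and only if $\langle G,u\rangle\sim_{\mathbb Q}\langle H,v\rangle$.
   Context: A (partially) ordered abelian group $G$ with a fixed order-unit $u$ is denoted $\langle G,u\rangle$. An order-unit is an element $u\in G^+$ such that every $x\in G$ satisfies $x\le nu$ for some natural number $n$. A homomorphism between ordered abelian groups with order-unit is normalized if it maps order-unit to order-unit; isomorphisms of ordered abelian groups with order-units are normalized order isomorphisms. A simplicial group is $\mathbb Z^r$ ($r$ a non-negative integer) with positive cone $\{(x_1,\dots,x_r): x_i\ge 0 \text{ for all } i\}$. A dimension group is a countable partially ordered abelian group that is a directed, unperforated interpolation group; equivalently, a direct limit of a sequence of simplicial groups and positive homomorphisms in the category of ordered abelian groups. A homomorphism $\alpha:\mathbb Z^r\to\mathbb Z^s$ is non-mixing if $\alpha(x_1,\dots,x_r)=(k_1x_{i_1},\dots,k_sx_{i_s})$ with $i_j\in\{1,\dots,r\}$ for each $j\le s$; by convention a non-mixing homomorphism is positive exactly when each $k_j$ is a positive integer. $\overrightarrow{\mathfrak D}$ is the class of all dimension groups that arise as the limit of a direct sequence of simplicial groups and positive non-mixing homomorphisms. The tensor product $G\otimes H$ of ordered abelian groups is the tensor product of abelian groups with positive cone consisting of all finite sums of elements $x\otimes y$ with $x\in G^+$, $y\in H^+$; and $\langle G,u\rangle\otimes\langle H,v\rangle$ has order-unit $u\otimes v$. $\mathbb Q$ denotes the rationals with usual order and order-unit $1$.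 For dimension groups with order-units, $\langle G,u\rangle\sim_{\mathbb Q}\langle H,v\rangle$ means $\langle G,u\rangle\otimes\mathbb Q\cong\langle H,v\rangle\otimes\mathbb Q$ as ordered abelian groups with order-units. $S(G,u)$ is the state space of $\langle G,u\rangle$: the set of all positive homomorphisms $s:G\to\mathbb R$ with $s(u)=1$, with the relative topology from $\mathbb R^G$; it is a compact convex set. $S(G,u)\cong S(H,v)$ means affinely homeomorphic. *)

(* Defs.v *)
From HB Require Import structures.
From mathcomp Require Import all_boot all_order all_algebra generic_quotient.
From mathcomp Require Import all_classical all_reals all_analysis.
From mathcomp.multinomials Require Import freeg.

Set Implicit Arguments.
Unset Strict Implicit.
Unset Printing Implicit Defensive.

Import Order.TTheory GRing.Theory Num.Theory.
Import numFieldNormedType.Exports.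

Local Open Scope classical_set_scope.
Local Open Scope ring_scope.

(* An ordered abelian group is given by its positive cone.  The record only   *)
(* asks for a translation-invariant preorder; antisymmetry is the separate    *)
(* predicate [partially_ordered], so that tensor products can be formed       *)
(* without first proving that their cone is proper.                           *)
Record oagroup := OAGroup {
  oag_sort :> zmodType;
  pos : set oag_sort;
  pos0 : pos 0;
  posD : forall x y, pos x -> pos y -> pos (x + y)
}.
Arguments pos {_} _.

Definition partially_ordered (G : oagroup) : Prop :=
  forall x : G, pos x -> pos (- x) -> x = 0.

Definition ole (G : oagroup) (x y : G) : Prop := pos (y - x).

Definition order_unit (G : oagroup) (u : G) : Prop :=
  pos u /\ forall x : G, exists n : nat, ole x (u *+ n).

Definition positive_hom (G H : oagroup) (f : G -> H) : Prop :=
  zmod_morphism f /\ forall x, pos x -> pos (f x).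

Definition isomorphic_unit (G : oagroup) (u : G) (H : oagroup) (v : H) : Prop :=
  exists f : G -> H,
    [/\ bijective f, zmod_morphism f, forall x, pos x <-> pos (f x) & f u = v].

Section DimensionGroup.
Variable G : oagroup.

Definition directed : Prop :=
  forall x y : G, exists z : G, ole x z /\ ole y z.

Definition unperforated : Prop :=
  forall (x : G) (n : nat), (0 < n)%N -> pos (x *+ n) -> pos x.

Definition interpolation : Prop :=
  forall x1 x2 y1 y2 : G, ole x1 y1 -> ole x1 y2 -> ole x2 y1 -> ole x2 y2 ->
    exists z : G, [/\ ole x1 z, ole x2 z, ole z y1 & ole z y2].

Definition dimension_group : Prop :=
  [/\ partially_ordered G, countable [set: G], directed, unperforated
    & interpolation].

End DimensionGroup.

Section Simplicial.
Variable r : nat.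

Definition simplicial_pos : set 'rV[int]_r := [set x | forall i, 0 <= x 0 i].

Fact simplicial_pos0 : simplicial_pos 0.
Proof. by move=> i; rewrite mxE. Qed.

Fact simplicial_posD x y :
  simplicial_pos x -> simplicial_pos y -> simplicial_pos (x + y).
Proof. by move=> hx hy i; rewrite mxE addr_ge0. Qed.

Definition simplicial : oagroup := OAGroup simplicial_pos0 simplicial_posD.

End Simplicial.

(* Positivity of a non-mixing map means that every multiplier is a positive   *)
(* integer: the multiplier 0 is excluded.                                     *)
Definition positive_nonmixing (r s : nat)
    (alpha : simplicial r -> simplicial s) : Prop :=
  exists (k : 'I_s -> int) (i : 'I_s -> 'I_r),
    (forall j, 0 < k j) /\
    (forall (x : 'rV[int]_r) (j : 'I_s), (alpha x : 'rV[int]_s) 0 j = k j * x 0 (i j)).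

(* Colimits of sequences in the category of partially ordered abelian groups  *)
(* and positive homomorphisms.                                                *)
Definition cocone (A : nat -> oagroup) (alpha : forall n, A n -> A n.+1)
    (G : oagroup) (phi : forall n, A n -> G) : Prop :=
  (forall n, positive_hom (phi n)) /\
  (forall n (x : A n), phi n.+1 (alpha n x) = phi n x).

Definition is_direct_limit (A : nat -> oagroup)
    (alpha : forall n, A n -> A n.+1)
    (G : oagroup) (phi : forall n, A n -> G) : Prop :=
  [/\ partially_ordered G,
      cocone alpha phi
    & forall (K : oagroup) (psi : forall n, A n -> K),
        partially_ordered K -> cocone alpha psi ->
        exists! f : G -> K,
          positive_hom f /\ forall n (x : A n), f (phi n x) = psi n x].

Definition nonmixing_dimension_group (G : oagroup) : Prop :=
  dimension_group G /\
  exists (r : nat -> nat)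
         (alpha : forall n, simplicial (r n) -> simplicial (r n.+1))
         (phi : forall n, simplicial (r n) -> G),
    (forall n, positive_nonmixing (alpha n)) /\
    is_direct_limit (A := fun n => simplicial (r n)) alpha phi.

Section TensorGroup.
Variables G H : zmodType.

Let F : zmodType := {freeg (G * H)%type / int}.
Let gen (x : G) (y : H) : F := << (x, y) >>.

(* Membership in the subgroup generated by the bilinearity relations. *)
Definition tensor_null_prop (z : F) : Prop :=
  forall S : {pred F}, zmod_closed S ->
    (forall x x' y, gen (x + x') y - gen x y - gen x' y \in S) ->
    (forall x y y', gen x (y + y') - gen x y - gen x y' \in S) ->
    z \in S.

Definition tensor_null : {pred F} := [pred z | `[< tensor_null_prop z >]].

Fact tensor_nullP z : reflect (tensor_null_prop z) (z \in tensor_null).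
Proof. exact: asboolP. Qed.

Fact tensor_null_closed : zmod_closed tensor_null.
Proof.
split=> [|z z' /tensor_nullP hz /tensor_nullP hz']; apply/tensor_nullP => S hS hl hr.
  by case: hS.
by case: (hS) => _; apply; [exact: hz | exact: hz'].
Qed.

HB.instance Definition _ :=
  GRing.isZmodClosed.Build F tensor_null tensor_null_closed.

Definition tensor_group : zmodType := Quotient.quot tensor_null.

Definition tens (x : G) (y : H) : tensor_group :=
  (\pi_(Quotient.quot tensor_null) (gen x y))%qT.

Lemma tensDl x x' y : tens (x + x') y = tens x y + tens x' y.
Proof.
rewrite /tens -(raddfD (\pi_(Quotient.quot tensor_null))%qT).
apply/eqP; rewrite -Quotient.idealrBE opprD addrA.
by apply/tensor_nullP=> S _ + _; exact.
Qed.

Lemma tensDr x y y' : tens x (y + y') = tens x y + tens x y'.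
Proof.
rewrite /tens -(raddfD (\pi_(Quotient.quot tensor_null))%qT).
apply/eqP; rewrite -Quotient.idealrBE opprD addrA.
by apply/tensor_nullP=> S _ _; exact.
Qed.

Let tpi (z : F) : tensor_group := (\pi_(Quotient.quot tensor_null) z)%qT.

Let tpiB : zmod_morphism tpi.
Proof. by move=> z z'; apply: (raddfB (\pi_(Quotient.quot tensor_null))%qT). Qed.

Let tpiK (w : tensor_group) : tpi (repr w) = w.
Proof. exact: reprK. Qed.

Let freeg_ext (K : zmodType) (g h : F -> K) :
  zmod_morphism g -> zmod_morphism h ->
  (forall x y, g (gen x y) = h (gen x y)) -> g =1 h.
Proof.
move=> gB hB gh.
pose gA := GRing.isZmodMorphism.Build F K g gB.
pose hA := GRing.isZmodMorphism.Build F K h hB.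
pose g' : {additive F -> K} := HB.pack g gA.
pose h' : {additive F -> K} := HB.pack h hA.
suff gh' : g' =1 h' by [].
elim/freeg_ind_dom0 => [|k [x y] D _ _ IH]; first by rewrite !raddf0.
rewrite !raddfD IH; congr (_ + _).
have -> : << k *g (x, y) >> = gen x y *~ k by rewrite /gen freegU_mulz intz.
by rewrite !raddfMz; congr (_ *~ _); exact: gh.
Qed.

Lemma tensor_universal (K : zmodType) (b : G -> H -> K) :
  (forall x x' y, b (x + x') y = b x y + b x' y) ->
  (forall x y y', b x (y + y') = b x y + b x y') ->
  exists! f : tensor_group -> K,
    zmod_morphism f /\ forall x y, f (tens x y) = b x y.
Proof.
move=> bDl bDr.
pose g : F -> K := fglift (M := zmodule K) (fun p : G * H => b p.1 p.2).
have gB : zmod_morphism g := @lift_is_additive int (G * H)%type (zmodule K) _.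
have g_gen x y : g (gen x y) = b x y by rewrite /g liftU scale1r.
pose ker : {pred F} := [pred z | g z == 0].
have g_null z : z \in tensor_null -> g z = 0.
  move=> /tensor_nullP hz; apply/eqP; apply: (hz ker).
  - split=> [|z1 z2]; first by rewrite inE -(subrr (0 : F)) gB subrr.
    by rewrite !inE gB => /eqP -> /eqP ->; rewrite subrr.
  - by move=> x x' y; rewrite inE !gB !g_gen bDl addrAC addrK subrr.
  - by move=> x y y'; rewrite inE !gB !g_gen bDr addrAC addrK subrr.
have g_repr z : g (repr (tpi z)) = g z.
  apply/eqP; rewrite -subr_eq0 -gB; apply/eqP/g_null.
  by rewrite Quotient.idealrBE reprK.
exists (fun w => g (repr w)); split.
  split=> [w w'|x y]; last by rewrite g_repr g_gen.
  by rewrite -gB -[RHS]g_repr tpiB !tpiK.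
move=> f [fB f_tens]; apply/funext => w; rewrite -[w in RHS]tpiK.
apply: (freeg_ext (h := f \o tpi)) => // [z z'|x y] /=; first by rewrite tpiB fB.
by rewrite f_tens g_gen.
Qed.

End TensorGroup.

Section TensorOrder.
Variables G H : oagroup.

Definition tensor_pos : set (tensor_group G H) :=
  [set z | exists s : seq (G * H),
     (forall p, p \in s -> pos p.1 /\ pos p.2) /\
     z = \sum_(p <- s) tens p.1 p.2].

Fact tensor_pos0 : tensor_pos 0.
Proof. by exists [::]; rewrite big_nil. Qed.

Fact tensor_posD z z' : tensor_pos z -> tensor_pos z' -> tensor_pos (z + z').
Proof.
move=> [s [hs ->]] [s' [hs' ->]]; exists (s ++ s'); split; last by rewrite big_cat.
by move=> p; rewrite mem_cat => /orP[/hs|/hs'].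
Qed.

Definition tensor : oagroup := OAGroup tensor_pos0 tensor_posD.

End TensorOrder.

Definition rat_oag : oagroup :=
  @OAGroup rat [set q : rat | 0 <= q] (lexx 0) (fun x y => @addr_ge0 _ x y).

Definition rat_equivalent (G : oagroup) (u : G) (H : oagroup) (v : H) : Prop :=
  @isomorphic_unit (tensor G rat_oag) (tens u 1) (tensor H rat_oag) (tens v 1).

Section States.
Variable R : realType.

Definition state_space (G : oagroup) (u : G) : set {ptws G -> R} :=
  [set s | [/\ zmod_morphism (s : G -> R), forall x, pos x -> 0 <= s x & s u = 1]].

Definition affinely_homeomorphic (X Y : Type)
    (A : set {ptws X -> R}) (B : set {ptws Y -> R}) : Prop :=
  exists (f : {ptws X -> R} -> {ptws Y -> R})
         (g : {ptws Y -> R} -> {ptws X -> R}),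
    [/\ [/\ forall s, A s -> B (f s), forall t, B t -> A (g t),
            forall s, A s -> g (f s) = s & forall t, B t -> f (g t) = t],
        forall (s s' : {ptws X -> R}) (c : R), A s -> A s' -> 0 <= c <= 1 ->
          f (fun x => c * s x + (1 - c) * s' x)
          = (fun y => c * f s y + (1 - c) * f s' y),
        {within A, continuous f}
      & {within B, continuous g}].

End States.

Arguments state_space R {G} u.

(* Main.v *)
Require Import Defs.
From HB Require Import structures.
From mathcomp Require Import all_boot all_order all_algebra generic_quotient.
From mathcomp Require Import all_classical all_reals all_analysis.
From mathcomp.multinomials Require Import freeg.
From mathcomp Require Import ring zify.

(** A positive non-mixing map Z^r -> Z^s sends the i-th basis vector to a
    positive combination of basis vectors, and distinct basis vectors to
    combinations with disjoint supports. A limit G of such maps is therefore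
    described by a tree: its level n consists of the images in G of the basis
    vectors of the n-th simplicial group, and every node is a positive integral
    combination of its children (the record [tree_basis]). Positive functionals
    on G are exactly the compatible systems of nonnegative weights on the nodes,
    that is, measures on the compact space X of infinite branches, so S(G, u) is
    the simplex of probability measures on X, and G tensored with the rationals
    is the group of locally constant functions from X to the rationals. The
    theorem follows because both objects are determined by X.

    The space X is never built; its points appear as extreme states. An extreme
    state is concentrated on one node at each level ([extreme_supported]),
    because a state is the sum of its restrictions to the subtrees below the
    nodes of a level. Conversely every branch carries an extreme state
    ([thread_functional], [thread_extreme]). Koenig's lemma supplies branches,
    which gives the positivity criterion [pos_of_extreme] and the density of
    convex combinations of extreme states ([extreme_cone_level]).

    From an affine homeomorphism of state spaces to an isomorphism: at a node
    supporting an extreme state s, the value s x is the quotient of the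
    coordinates of x and u there, so some positive multiple of x is
    integer-valued on all extreme states ([extreme_values_commensurable]).
    Carry the evaluation at this multiple to S(H, v): it is continuous, affine,
    and still integral on extreme states, since extreme states correspond. An
    integral continuous function is locally constant, hence by compactness it
    depends on a single level of the tree of H and is the evaluation at an
    element of H ([affine_represented]). Matching elements of the two tensor
    products with equal values on corresponding states gives a bijection, which
    preserves order in both directions because states detect positivity
    ([tensor_pos_of_states], [tensor_eq_of_states]).

    From an isomorphism to an affine homeomorphism: every element of the tensor
    product with the rationals has the form x (x) 1/n, a state s extends
    uniquely by x (x) q |-> q * s x, and pulling extended states back along the
    isomorphism is affine and pointwise continuous ([state_pullback]). *)

Set Implicit Arguments.
Unset Strict Implicit.
Unset Printing Implicit Defensive.

Import Order.TTheory GRing.Theory Num.Theory.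
Import numFieldNormedType.Exports.

Local Open Scope classical_set_scope.
Local Open Scope ring_scope.

(** * Additive maps and branches of finitely branching trees *)

Section ZmodMorphism.
Variables (U V : zmodType) (f : U -> V).
Hypothesis hf : zmod_morphism f.

Definition additive_of : {additive U -> V} :=
  HB.pack f (GRing.isZmodMorphism.Build U V f hf).

Lemma zmorph0 : f 0 = 0.
Proof. exact: (raddf0 additive_of). Qed.
Lemma zmorphN x : f (- x) = - f x.
Proof. exact: (raddfN additive_of). Qed.
Lemma zmorphD x y : f (x + y) = f x + f y.
Proof. exact: (raddfD additive_of). Qed.
Lemma zmorphMn x n : f (x *+ n) = f x *+ n.
Proof. exact: (raddfMn additive_of). Qed.
Lemma zmorphMz x n : f (x *~ n) = f x *~ n.
Proof. exact: (raddfMz additive_of). Qed.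
Lemma zmorph_sum I (r : seq I) (P : pred I) (F : I -> U) :
  f (\sum_(i <- r | P i) F i) = \sum_(i <- r | P i) f (F i).
Proof. exact: (raddf_sum additive_of). Qed.

End ZmodMorphism.

Lemma choice_dep (T : Type) (U : T -> Type) (Q : forall x, U x -> Prop) :
  (forall x, exists u, Q x u) -> exists f, forall x, Q x (f x).
Proof.
by move=> hQ; exists (fun x => sval (cid (hQ x))) => x; case: (cid _).
Qed.

Section Koenig.
Variables (rk : nat -> nat) (par : forall n, 'I_(rk n.+1) -> 'I_(rk n)).

Definition thread (y : forall n, 'I_(rk n)) := forall n, y n = par (y n.+1).

(** Along an ultrafilter refining the eventual filter, the ancestors at a fixed
    level n of a node chosen at level m have a limit as m grows, since level n
    is finite; these limits form the branch. *)
Lemma koenig (P : forall n, 'I_(rk n) -> Prop) :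
  (forall n j, P n.+1 j -> P n (par j)) -> (forall n, exists j, P n j) ->
  exists2 y, thread y & forall n, P n (y n).
Proof.
move=> Ppar Pex.
have [d dP] := choice_dep Pex.
(* the ancestors of a node of level m; values at levels above m are arbitrary *)
have branch m (j : 'I_(rk m)) : exists y : forall n, 'I_(rk n),
    y m = j /\ forall n, (n < m)%N -> y n = par (y n.+1).
  elim: m j => [|m IH] j.
    exists (eqtype.dfwith d j); split=> //; exact: dfwith_in.
  have [y [ym yp]] := IH (par j).
  exists (eqtype.dfwith y j); split=> [|n]; first exact: dfwith_in.
  rewrite ltnS leq_eqVlt => /orP[/eqP ->|nm].
    by rewrite dfwith_in dfwith_out ?ym//; lia.
  have [h1 h2] : m.+1 != n /\ m.+1 != n.+1 by clear -nm; split; lia.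
  by rewrite (eqtype.dfwith_out _ _ h1) (eqtype.dfwith_out _ _ h2) yp.
have [Y YP] := choice_dep (fun m => branch m (d m)).
have PY m n : (n <= m)%N -> P n (Y m n).
  have [Ym Yp] := YP m => /subKn <-; elim: (m - n)%N => [|k IH].
    by rewrite subn0 Ym.
  have [km|mk] := ltnP k m; last first.
    have e1 : (m - k.+1 = 0)%N by lia.
    have e2 : (m - k = 0)%N by lia.
    by rewrite e1 -e2.
  have e : (m - k = (m - k.+1).+1)%N by lia.
  rewrite Yp; last by lia.
  by apply: Ppar; rewrite -e.
have [U [UU Uoo]] := ultraFilterLemma eventually_filter.
have lim n : exists j, U [set m | Y m n = j].
  apply: contrapT => /forallNP nj.
  have : U (fun m => forall j, ~ Y m n = j).
    apply: (@filter_forall _ _ (fun j m => ~ Y m n = j)) => j.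
    by have [/nj|] := in_ultra_setVsetC [set m | Y m n = j] UU.
  by move/filter_ex => [m /(_ (Y m n))].
have [y yP] := choice_dep lim.
have large n : U [set m | (n <= m)%N] by apply: Uoo; exists n.
exists y => n.
  have [m [[ynm <-] nm]] := filter_ex (filterI (filterI (yP n) (yP n.+1)) (large n.+1)).
  by rewrite -ynm; have [_] := YP m; apply.
have [m [<- nm]] := filter_ex (filterI (yP n) (large n)).
exact: PY.
Qed.

End Koenig.

(** * Positive functionals, states and trees generating an ordered group *)

Section Functionals.
Variables (R : realType) (G : oagroup).
Implicit Types s : G -> R.

Definition functional s := zmod_morphism s /\ forall x, pos x -> 0 <= s x.

Lemma functionalD s1 s2 :
  functional s1 -> functional s2 -> functional (fun x => s1 x + s2 x).
Proof.
move=> [a1 p1] [a2 p2]; split=> [x y|x xp]; first by rewrite a1 a2; ring.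
by rewrite addr_ge0 ?p1 ?p2.
Qed.

Lemma functionalZ c s :
  0 <= c -> functional s -> functional (fun x => c * s x).
Proof.
move=> c0 [a p]; split=> [x y|x xp]; first by rewrite a; ring.
by rewrite mulr_ge0 ?p.
Qed.

(** Every x and -x lie below multiples of u, which makes a positive functional
    that kills u nonpositive at both. *)
Lemma functional_unit_eq0 (u : G) s :
  order_unit u -> functional s -> s u = 0 -> forall x, s x = 0.
Proof.
move=> [_ hu] [sB sp] su0.
have le0 x : s x <= 0.
  have [n /sp] := hu x.
  by rewrite sB (zmorphMn sB) su0 mul0rn sub0r oppr_ge0.
move=> x; apply/eqP; rewrite eq_le le0/=.
by have := le0 (- x); rewrite (zmorphN sB) oppr_le0.
Qed.

Lemma functional_unit_gt0 (u : G) s x :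
  order_unit u -> functional s -> s x != 0 -> 0 < s u.
Proof.
move=> hu sf; apply: contra_neqT => su.
apply: (functional_unit_eq0 hu sf); apply/eqP.
by rewrite eq_le leNgt su (sf.2 _ hu.1).
Qed.

Variable u : G.

Definition extreme s := state_space R u s /\
  forall s1 s2 c, state_space R u s1 -> state_space R u s2 -> 0 < c < 1 ->
    s = (fun x => c * s1 x + (1 - c) * s2 x) -> s1 = s.

Lemma stateE s : state_space R u s <-> functional s /\ s u = 1.
Proof. by split=> [[]|[[]]]. Qed.

Lemma state_normalize s : functional s -> 0 < s u ->
  state_space R u (fun x => (s u)^-1 * s x).
Proof.
move=> sf su; apply/stateE; split; last by rewrite mulVf ?gt_eqF.
by apply: functionalZ; rewrite // invr_ge0 ltW.
Qed.

End Functionals.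

(** The tree attached to a sequence of non-mixing maps: [rk n] nodes at level n,
    [par] the index selected by the next map and [multiplier] its coefficient.
    The last field is the universal property of the limit for maps into the
    reals: it turns compatible weights into functionals directly, without a
    description of the relations between the nodes. *)
Record tree_basis (R : realType) (G : oagroup) := TreeBasis {
  rk : nat -> nat;
  par : forall n, 'I_(rk n.+1) -> 'I_(rk n);
  multiplier : forall n, 'I_(rk n.+1) -> int;
  node : forall n, 'I_(rk n) -> G;
  multiplier_gt0 : forall n j, 0 < @multiplier n j;
  node_pos : forall n i, pos (@node n i);
  node_split : forall n i,
    @node n i = \sum_(j | par j == i) node j *~ multiplier j;
  pos_combo : forall x, pos x -> exists n (xi : 'I_(rk n) -> int),
    (forall i, 0 <= xi i) /\ x = \sum_i node i *~ xi i;
  functional_of_weights : forall w : forall n, 'I_(rk n) -> R,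
    (forall n i, 0 <= w n i) ->
    (forall n i, w n i = \sum_(j | par j == i) (multiplier j)%:~R * w n.+1 j) ->
    exists2 s : G -> R, functional s & forall n i, s (@node n i) = w n i
}.

Section TreeBasis.
Variables (R : realType) (G : oagroup).
Hypothesis Gdir : directed G.

Section Levels.
Variable B : tree_basis R G.

Definition in_level n (x : G) :=
  exists xi : 'I_(rk B n) -> int, x = \sum_i node i *~ xi i.

Lemma combo_split n (xi : 'I_(rk B n) -> int) :
  \sum_i node i *~ xi i = \sum_(j < rk B n.+1) node j *~ (multiplier j * xi (par j)).
Proof.
rewrite [RHS](partition_big (@par _ _ B n) predT)//=.
apply: eq_bigr => i _; rewrite node_split mulrz_suml.
by apply: eq_bigr => j /eqP <-; rewrite mulrzA.
Qed.

Lemma in_levelS n x : in_level n x -> in_level n.+1 x.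
Proof. by move=> [xi ->]; rewrite combo_split; exists (fun j => multiplier j * xi (par j)). Qed.

Lemma in_level_le n m x : (n <= m)%N -> in_level n x -> in_level m x.
Proof.
by move=> /subnK <-; elim: (m - n)%N => // k IH /IH; exact: in_levelS.
Qed.

Lemma in_levelB n x y : in_level n x -> in_level n y -> in_level n (x - y).
Proof.
move=> [xi ->] [eta ->]; exists (fun i => xi i - eta i).
by rewrite -sumrB; apply: eq_bigr => i _; rewrite mulrzBr.
Qed.

Lemma in_some_level x : exists n, in_level n x.
Proof.
have [z [z0 zx]] := Gdir 0 x.
have [n [xi [_ zE]]] := pos_combo B (z0 : pos (z - 0)).
have [m [eta [_ yE]]] := pos_combo B (zx : pos (z - x)).
exists (maxn n m); have -> : x = (z - 0) - (z - x) by rewrite subr0 opprB addrC subrK.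
apply: in_levelB.
  by apply: (@in_level_le n); [exact: leq_maxl|exists xi].
by apply: (@in_level_le m); [exact: leq_maxr|exists eta].
Qed.

Lemma in_common_level (xs : seq G) : exists n, forall x, x \in xs -> in_level n x.
Proof.
elim: xs => [|x xs [n nP]]; first by exists 0%N.
have [m xm] := in_some_level x; exists (maxn n m) => z.
rewrite inE => /orP[/eqP ->|/nP].
  exact: in_level_le (leq_maxr _ _) xm.
exact/in_level_le/leq_maxl.
Qed.

Lemma eval_combo (V : zmodType) (s : G -> V) n (xi : 'I_(rk B n) -> int) :
  zmod_morphism s -> s (\sum_i node i *~ xi i) = \sum_i s (node i) *~ xi i.
Proof.
move=> sB; rewrite (zmorph_sum sB); apply: eq_bigr => i _.
exact: zmorphMz.
Qed.

Lemma eq_on_level (V : zmodType) (s t : G -> V) n :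
  zmod_morphism s -> zmod_morphism t ->
  (forall i, s (@node _ _ B n i) = t (node i)) ->
  forall x, in_level n x -> s x = t x.
Proof.
move=> sB tB st x [xi ->]; rewrite !eval_combo//.
by apply: eq_bigr => i _; rewrite st.
Qed.

(** A functional supported at one node of a level corresponds to a measure on
    branches that is carried by the branches through this node. *)
Definition supported_at n (j : 'I_(rk B n)) (s : G -> R) :=
  forall i, i != j -> s (node i) = 0.

Lemma eval_supported n (j : 'I_(rk B n)) (s : G -> R) xi :
  zmod_morphism s -> supported_at j s ->
  s (\sum_i node i *~ xi i) = s (node j) *~ xi j.
Proof.
move=> sB sj; rewrite eval_combo// (bigD1 j)//= big1 ?addr0// => i ij.
by rewrite sj// mul0rz.
Qed.

Lemma supported_par n (j : 'I_(rk B n.+1)) (s : G -> R) :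
  zmod_morphism s -> supported_at j s -> supported_at (par j) s.
Proof.
move=> sB sj i ij; rewrite node_split (zmorph_sum sB) big1// => k /eqP ki.
rewrite (zmorphMz sB) sj ?mul0rz//; apply: contra_neq ij => <-; exact/esym.
Qed.

(** On a level containing u, normalisation at u fixes the only coefficient of a
    state supported at one node. *)
Lemma supported_eq (u : G) n (j : 'I_(rk B n)) (s t : G -> R) :
  in_level n u -> state_space R u s -> state_space R u t ->
  supported_at j s -> supported_at j t ->
  forall x, in_level n x -> s x = t x.
Proof.
move=> [ui uE] [sB _ su] [tB _ tu] sj tj x xn.
apply: (eq_on_level sB tB) xn => i.
have [->|ij] := eqVneq i j; last by rewrite sj// tj.
move: su tu; rewrite uE !(eval_supported _ _ sj, eval_supported _ _ tj)//.
rewrite -mulrzr => su; rewrite -mulrzr => tu.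
have uj : (ui j)%:~R != 0 :> R.
  by apply/eqP => uj0; move: su; rewrite uj0 mulr0 => /eqP; rewrite eq_sym oner_eq0.
by apply: (mulIf uj); rewrite su tu.
Qed.

Fixpoint root_of n : 'I_(rk B n) -> 'I_(rk B 0) :=
  if n is n'.+1 then fun j => root_of (par j) else fun j => j.

(** The product of the multipliers along the path to level 0. *)
Fixpoint weight n : 'I_(rk B n) -> int :=
  if n is n'.+1 then fun j => multiplier j * weight (par j) else fun=> 1.

Lemma weight_gt0 n (j : 'I_(rk B n)) : 0 < weight j.
Proof. by elim: n j => //= n IH j; rewrite mulr_gt0 ?multiplier_gt0. Qed.

Lemma combo_descend n (xi : 'I_(rk B 0) -> int) :
  \sum_i node i *~ xi i = \sum_(j < rk B n) node j *~ (weight j * xi (root_of j)).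
Proof.
elim: n => [|n IH]; first by apply: eq_bigr => i _; rewrite mul1r.
by rewrite IH combo_split; apply: eq_bigr => j _; rewrite mulrA.
Qed.

End Levels.
End TreeBasis.

(** * Extreme states and branches *)

Section Pure.
Variables (R : realType) (G : oagroup).

(** Statements about an arbitrary level reduce to level 0 by discarding the
    first levels of the tree. The weights of the discarded level are forced by
    those of its children. *)
Definition drop_root (B : tree_basis R G) : tree_basis R G.
Proof.
refine (@TreeBasis R G (fun n => rk B n.+1) (fun n => @par _ _ B n.+1)
  (fun n => @multiplier _ _ B n.+1) (fun n => @node _ _ B n.+1) _ _ _ _ _).
- by move=> n j; exact: multiplier_gt0.
- by move=> n i; exact: node_pos.
- by move=> n i; exact: node_split.
- move=> x /(pos_combo B) [n [xi [xi0 ->]]].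
  exists n, (fun j => multiplier j * xi (par j)); split; last exact: combo_split.
  by move=> j; rewrite mulr_ge0// ltW// multiplier_gt0.
- move=> w w0 wS.
  pose w' n : 'I_(rk B n) -> R := if n is n'.+1 then w n'
    else fun i => \sum_(j | par j == i) (multiplier j)%:~R * w 0%N j.
  have mul0 n (j : 'I_(rk B n.+1)) : 0 <= (multiplier j)%:~R :> R.
    by rewrite ler0z ltW// multiplier_gt0.
  have [| |s sf sw] := @functional_of_weights _ _ B w'.
  + by move=> [|n] i //=; apply: sumr_ge0 => j _; rewrite mulr_ge0.
  + by move=> [|n] i //; exact: wS.
  + by exists s => // n i; exact: (sw n.+1).
Defined.

Variable u : G.
Hypothesis Gdir : directed G.
Hypothesis Gu : order_unit u.

Section Fixed.
Variable B : tree_basis R G.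
Hypothesis uB : in_level B 0 u.

Lemma u_in_level n : in_level B n u.
Proof. exact: in_level_le uB. Qed.

(** The point mass at a branch: the weight of its node at level n is the inverse
    of the product of the multipliers met so far. *)
Lemma thread_functional (y : forall n, 'I_(rk B n)) :
  thread (@par _ _ B) y ->
  exists s : G -> R, [/\ functional s, 0 < s u, s (node (y 0%N)) = 1
    & forall n, supported_at (y n) s].
Proof.
move=> yP.
pose c := fix c n : R := if n is n'.+1 then c n' / (multiplier (y n'.+1))%:~R else 1.
have c0 n : 0 < c n.
  by elim: n => //= n IH; rewrite divr_gt0// ltr0z multiplier_gt0.
pose w n (i : 'I_(rk B n)) : R := if i == y n then c n else 0.
have [| |s sf sw] := @functional_of_weights _ _ B w.
- by move=> n i; rewrite /w; case: ifP => // _; rewrite ltW.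
- move=> n i; rewrite /w yP.
  have [iy|iy] := eqVneq i (par (y n.+1)).
    rewrite (bigD1 (y n.+1)) ?iy//= eqxx big1 ?addr0.
      by rewrite mulrC divfK// intr_eq0 gt_eqF// multiplier_gt0.
    by move=> j /andP[_ /negbTE ->]; rewrite mulr0.
  rewrite big1// => j /eqP ji; case: eqP => [jy|]; last by rewrite mulr0.
  by case/eqP: iy; rewrite -ji jy.
have s1 : s (node (y 0%N)) = 1 by rewrite sw /w eqxx.
exists s; split=> // [|n i iy]; last by rewrite sw /w (negbTE iy).
by apply: (functional_unit_gt0 (x := node (y 0%N)) Gu sf); rewrite s1; exact: oner_neq0.
Qed.

(** In a convex decomposition of a state supported along a branch, both summands
    vanish off the branch by positivity, so they are determined by
    [supported_eq]. *)
Lemma thread_extreme (y : forall n, 'I_(rk B n)) s :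
  state_space R u s -> (forall n, supported_at (y n) s) -> extreme u s.
Proof.
move=> ss sy; split=> // s1 s2 c h1 h2 /andP[c0 c1] sE.
have s1y n : supported_at (y n) s1.
  move=> i iy; have := sy n i iy; rewrite sE.
  have [_ p1 _] := h1; have [_ p2 _] := h2 => /eqP.
  rewrite paddr_eq0; last 2 first.
    by apply: mulr_ge0; [exact: ltW|exact: (p1 _ (node_pos _))].
    by apply: mulr_ge0; [rewrite subr_ge0 ltW|exact: (p2 _ (node_pos _))].
  by rewrite mulf_eq0 gt_eqF//= => /andP[/eqP].
apply/funext => x; have [n xn] := in_some_level Gdir B x.
exact: (supported_eq (u_in_level n) h1 ss (s1y n) (sy n)).
Qed.

(** The restriction of a measure to the branches through a root i. *)
Lemma functional_restrict (i : 'I_(rk B 0)) (s : G -> R) : functional s ->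
  exists s' : G -> R, [/\ functional s', functional (fun x => s x - s' x),
   s' (node i) = s (node i) & supported_at i s'].
Proof.
move=> sf; have [sB s0] := sf.
pose w n (j : 'I_(rk B n)) : R := if root_of j == i then s (node j) else 0.
have [| |s' s'f s'w] := @functional_of_weights _ _ B w.
- by move=> n j; rewrite /w; case: ifP => // _; exact: (s0 _ (node_pos _)).
- move=> n j; rewrite /w; have [ji|ji] := eqVneq.
    rewrite node_split (zmorph_sum sB); apply: eq_bigr => k /eqP kj /=.
    by rewrite kj ji eqxx (zmorphMz sB) mulrzl.
  by rewrite big1// => k /eqP /= ->; rewrite (negbTE ji) mulr0.
have dB : zmod_morphism (fun x => s x - s' x).
  by move=> x y; rewrite sB s'f.1; ring.
exists s'; split=> //; last 2 first.
- by rewrite s'w /w eqxx.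
- by move=> j ji; rewrite s'w /w /= (negbTE ji).
split=> // x /(pos_combo B) [n [xi [xi0 ->]]].
rewrite (eval_combo _ dB); apply: sumr_ge0 => j _.
rewrite mulrz_ge0// s'w /w; case: ifP => _; first by rewrite subrr.
by rewrite subr0; exact: (s0 _ (node_pos _)).
Qed.

(** An extreme state is proportional to each of its nonzero restrictions. *)
Lemma extreme_supported0 s : extreme u s ->
  exists i : 'I_(rk B 0), supported_at i s.
Proof.
move=> [ss sext]; have [sf su] := (stateE _ _).1 ss.
have [sB s0] := sf.
have [i si] : exists i : 'I_(rk B 0), s (node i) != 0.
  apply: contrapT => /forallNP si; have [xi uE] := uB.
  move/eqP: su; rewrite uE (eval_combo _ sB) big1 ?(eq_sym 0) ?oner_eq0//.
  by move=> i _; have /negP := si i; rewrite negbK => /eqP ->; rewrite mul0rz.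
have [s' [s'f df s'i s'supp]] := functional_restrict i sf.
exists i => j ji.
have s'u : 0 < s' u.
  by apply: (functional_unit_gt0 (x := node i) Gu s'f); rewrite s'i.
(* if the restriction has full mass, the rest of s vanishes; otherwise s is a
   proper convex combination of the normalised restriction and the rest *)
have [du0|du0] := eqVneq (s u - s' u) 0.
  have /eqP := functional_unit_eq0 Gu df du0 (node j).
  by rewrite subr_eq0 s'supp// => /eqP.
have du : 0 < s u - s' u := functional_unit_gt0 Gu df du0.
have s'1 := state_normalize s'f s'u.
have d1 := state_normalize df du.
have <- : (fun x => (s' u)^-1 * s' x) = s.
  apply: (sext _ _ (s' u) s'1 d1); first by rewrite s'u/= -subr_gt0 -su.
  apply/funext => x; rewrite mulVKf ?gt_eqF// su mulVKf; last by rewrite -su.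
  by rewrite addrC subrK.
by rewrite s'supp// mulr0.
Qed.

(** If the subtree below a node dies out, expanding the node at a level where
    nothing is left shows that it is zero in G; otherwise Koenig's lemma
    applies. *)
Lemma thread_through (i : 'I_(rk B 0)) : node i <> 0 ->
  exists2 y, thread (@par _ _ B) y & y 0%N = i.
Proof.
move=> i0.
have [|n|y yP yi] := @koenig (rk B) (@par _ _ B) (fun n j => root_of j = i).
- by [].
- apply: contrapT => /forallNP nj; apply: i0.
  have -> : node i = \sum_j node j *~ (j == i)%:Z :> G.
    rewrite (bigD1 i)//= big1 ?eqxx ?addr0// => j /negbTE ->.
    by rewrite mulr0z.
  rewrite (combo_descend n) big1// => j _.
  by case: eqP => [/nj//|_]; rewrite mulr0 mulr0z.
- by exists y => //; exact: (yi 0%N).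
Qed.

(** If x is not positive, then at every level some coefficient is negative, and
    its sign is that of the coefficient at the root below which it lies.
    Koenig's lemma gives a branch starting at such a root, and the point mass of
    this branch is negative at x. *)
Lemma pos_of_extreme0 x : in_level B 0 x ->
  (forall s : G -> R, extreme u s -> 0 <= s x) -> pos x.
Proof.
move=> [xi xE] hx; apply: contrapT => nx.
have [|n|y yP yi] :=
  @koenig (rk B) (@par _ _ B) (fun n j => xi (root_of j) < 0).
- by [].
- apply: contrapT => /forallNP nj; apply: nx.
  rewrite xE (combo_descend n); elim/big_rec: _ => [|j z _ zp].
    exact: pos0.
  apply: posD zp; have : 0 <= weight j * xi (root_of j).
    by apply: mulr_ge0; [exact/ltW/weight_gt0|rewrite leNgt; apply/negP/nj].
  case: (_ * _) => // k _; rewrite -pmulrn.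
  elim: k => [|k IH]; first by rewrite mulr0n; exact: pos0.
  by rewrite mulrS; apply: posD => //; exact: node_pos.
have [s [sf su s1 sy]] := thread_functional yP.
have se : extreme u (fun x => (s u)^-1 * s x).
  apply: (thread_extreme (y := y) (state_normalize sf su)) => n i iy.
  by rewrite sy// mulr0.
have sx : s x = (xi (y 0%N))%:~R.
  by rewrite xE (eval_supported _ sf.1 (sy 0%N)) s1.
have := hx _ se; rewrite sx pmulr_rge0 ?invr_gt0// ler0z leNgt.
by rewrite (yi 0%N).
Qed.

(** The convex cone generated by the extreme states, described by its
    induction principle. *)
Definition extreme_cone (t : G -> R) := forall D : set (G -> R),
  (forall s c, extreme u s -> 0 <= c -> D (fun x => c * s x)) ->
  (forall s1 s2, D s1 -> D s2 -> D (fun x => s1 x + s2 x)) ->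
  D (fun=> 0) -> D t.

(** Put the mass that t gives to a root on any single branch through it. *)
Lemma extreme_cone_level0 (t : G -> R) : functional t ->
  exists t' : G -> R, [/\ functional t', extreme_cone t' &
    forall i, t' (node i) = t (@node _ _ B 0 i)].
Proof.
move=> tf; have [tB t0] := tf.
have ex i : exists s : G -> R, [/\ functional s, supported_at i s,
    t (node i) * s (@node _ _ B 0 i) = t (node i) & extreme_cone (fun x => t (node i) * s x)].
  have [i0|i0] := pselect (node i = 0).
    exists (fun=> 0); rewrite i0 (zmorph0 tB); split=> //.
    - by split=> // x y; rewrite subr0.
    - by rewrite mulr0.
    - move=> D _ _ D0; suff -> : (fun=> 0 * 0) = (fun=> 0) :> (G -> R) by [].
      by apply/funext => x; rewrite mulr0.
  have [y yP <-] := thread_through i0.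
  have [s [sf su s1 sy]] := thread_functional yP.
  exists s; split=> //; first by rewrite s1 mulr1.
  move=> D De _ _.
  have -> : (fun x => t (node (y 0%N)) * s x) =
     (fun x => (t (node (y 0%N)) * s u) * ((s u)^-1 * s x)).
    by apply/funext => x; rewrite -mulrA mulVKf ?gt_eqF.
  apply: De; last by apply: mulr_ge0; [exact: (t0 _ (node_pos _))|exact: ltW].
  apply: (thread_extreme (y := y) (state_normalize sf su)) => n k ky.
  by rewrite sy// mulr0.
have [S SP] := choice ex.
exists (fun x => \sum_i t (node i) * S i x); split.
- split=> [x y|x xp].
    rewrite -sumrB; apply: eq_bigr => i _.
    by have [[sB _] _ _ _] := SP i; rewrite sB mulrBr.
  apply: sumr_ge0 => i _; have [[_ sp] _ _ _] := SP i.
  by apply: mulr_ge0; [exact: (t0 _ (node_pos _))|exact: sp].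
- move=> D De DD D0.
  rewrite (_ : (fun x => _) = \sum_i (fun x => t (node i) * S i x)); last first.
    by apply/funext => x; rewrite fct_sumE.
  elim/big_rec: _ => [|i s _ Ds]; first exact: D0.
  by have [_ _ _ Si] := SP i; exact: (DD _ _ (Si D De DD D0) Ds).
- move=> i; rewrite (bigD1 i)//= big1 ?addr0; first by have [] := SP i.
  by move=> j ji; have [_ sj _ _] := SP j; rewrite sj ?mulr0// eq_sym.
Qed.

End Fixed.

Lemma extreme_supported (B : tree_basis R G) n s : in_level B 0 u ->
  extreme u s -> exists i : 'I_(rk B n), supported_at i s.
Proof.
elim: n B => [|n IH] B uB se; first exact: extreme_supported0.
exact: (IH (drop_root B) (in_levelS uB) se).
Qed.

Lemma pos_of_extreme (B : tree_basis R G) x : in_level B 0 u ->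
  (forall s : G -> R, extreme u s -> 0 <= s x) -> pos x.
Proof.
move=> uB hx; have [n] := in_some_level Gdir B x.
elim: n B uB => [|n IH] B uB xn; first exact: (pos_of_extreme0 uB).
exact: (IH (drop_root B) (in_levelS uB) xn).
Qed.

Lemma extreme_cone_level (B : tree_basis R G) n (t : G -> R) :
  in_level B 0 u -> functional t ->
  exists t' : G -> R, [/\ functional t', extreme_cone t' &
    forall x, in_level B n x -> t' x = t x].
Proof.
elim: n B => [|n IH] B uB tf.
  have [t' [t'f t'e t't]] := extreme_cone_level0 uB tf; exists t'; split=> //.
  exact: (eq_on_level t'f.1 tf.1 t't).
exact: (IH (drop_root B) (in_levelS uB) tf).
Qed.

End Pure.

(** * Affine functions that are integral on extreme states *)

Section Representation.
Variables (R : realType) (G : oagroup) (u : G) (B : tree_basis R G).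
Hypothesis Gdir : directed G.
Hypothesis Gu : order_unit u.
Hypothesis uB : in_level B 0 u.

(** If s is supported at node i, then s x is the quotient of the coordinates of x
    and u at i; the product of the nonzero coordinates of u is a common
    denominator. *)
Lemma extreme_values_commensurable (x : G) : exists2 k : nat, (0 < k)%N &
  forall s : G -> R, extreme u s -> exists z : int, s x *+ k = z%:~R.
Proof.
have [n [xi xE]] := in_some_level Gdir B x.
have [ui uE] : in_level B n u := in_level_le (leq0n n) uB.
exists (\prod_(i | ui i != 0) `|ui i|%N)%N.
  by apply: prodn_cond_gt0 => i; rewrite absz_gt0.
move=> s se; have [[sB _ su] _] := se.
have [i si] := extreme_supported Gu n uB se.
move: su; rewrite uE xE !(eval_supported _ sB si) -mulrzr => su.
have ui0 : ui i != 0.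
  apply/eqP => ui0; move/eqP: su.
  by rewrite ui0 mulr0 eq_sym oner_eq0.
rewrite (bigD1 i)//=; set k := (\prod_(_ < _ | _) _)%N.
exists (sgz (ui i) * xi i * k%:Z).
rewrite !intrM -[LHS]mulr_natr natrM -mulrzr.
have -> : `|ui i|%:R = (ui i)%:~R * (sgz (ui i))%:~R :> R.
  by rewrite -intrM mulrC -abszEsg -pmulrn.
rewrite (_ : _ * _ = (s (node i) * (ui i)%:~R) *
   ((sgz (ui i))%:~R * (xi i)%:~R * k%:R)); last by ring.
by rewrite su mul1r.
Qed.

Variable a : (G -> R) -> R.
Hypothesis a_affine : forall s s' c, state_space R u s -> state_space R u s' ->
  0 <= c <= 1 -> a (fun x => c * s x + (1 - c) * s' x) = c * a s + (1 - c) * a s'.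
(* continuity of a, in the weak form that only retains exact agreement on a
   finite set of elements *)
Hypothesis a_local : forall t e, state_space R u t -> 0 < e ->
  exists xs : seq G, forall t', state_space R u t' ->
    (forall x, x \in xs -> t' x = t x) -> `|a t' - a t| < e.
Hypothesis a_int : forall s, extreme u s -> exists z : int, a s = z%:~R.

Lemma eq_int_near (x y : R) : (exists z : int, x = z%:~R) ->
  (exists z : int, y = z%:~R) -> `|x - y| < 1 -> x = y.
Proof.
move=> [p ->] [q ->]; rewrite -intrB -intr_norm.
rewrite (_ : 1 = 1%:~R :> R)// ltr_int => h.
by have -> : p = q by move: h; lia.
Qed.

(** If at every level some node supported two extreme states with different
    values, Koenig's lemma would give a branch of such nodes. By continuity at
    the point mass of this branch, all extreme states supported at one of its
    nodes of high enough level have values within 1 of its value, and integers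
    at distance less than 1 are equal. *)
Lemma locally_constant_on_extremes : exists n, forall (j : 'I_(rk B n)) s s',
  extreme u s -> extreme u s' -> supported_at j s -> supported_at j s' ->
  a s = a s'.
Proof.
pose bad n (j : 'I_(rk B n)) := exists s s', [/\ extreme u s, extreme u s',
  supported_at j s, supported_at j s' & a s <> a s'].
apply: contrapT => /forallNP hbad.
have [|n|y yP ybad] := @koenig (rk B) (@par _ _ B) bad.
- move=> n j [s [s' [se se' sj sj' ss']]]; exists s, s'; split=> //.
    by apply: supported_par sj; case: se => -[].
  by apply: supported_par sj'; case: se' => -[].
- apply: contrapT => /forallNP nj; apply: (hbad n) => j s s' se se' sj sj'.
  by apply: contrapT => ss'; apply: (nj j); exists s, s'.
have [s [sf su _ sy]] := thread_functional Gu yP.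
have st := state_normalize sf su; set t := (fun x : G => _ * _) in st.
have ty n : supported_at (y n) t by move=> i iy; rewrite /t sy// mulr0.
have te := thread_extreme Gdir uB st ty.
have [xs xsP] := a_local st (ltr01 : 0 < 1).
have [n nP] := in_common_level Gdir B xs.
have un : in_level B n u := in_level_le (leq0n n) uB.
have same s1 : extreme u s1 -> supported_at (y n) s1 -> a s1 = a t.
  move=> s1e s1y; apply: eq_int_near; [exact: a_int|exact: a_int|].
  apply: xsP s1e.1 _ => x /nP xn.
  exact: (supported_eq un s1e.1 st s1y (ty n)).
have [s1 [s2 [e1 e2 h1 h2 h]]] := ybad n.
by apply: h; rewrite (same s1)// (same s2).
Qed.

(** Once a depends on a single level, with value q j at node j, its
    representative is u with its coordinates at this level multiplied by q. *)
Lemma integral_on_extremes : exists y : G, forall s, extreme u s -> a s = s y.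
Proof.
have [n nP] := locally_constant_on_extremes.
have [q qP] : exists q : 'I_(rk B n) -> int, forall j s,
    extreme u s -> supported_at j s -> a s = (q j)%:~R.
  apply: (@choice_dep _ _ (fun j q => forall s, extreme u s -> supported_at j s ->
     a s = q%:~R)) => j.
  have [[s [se sj]]|nj] :=
    pselect (exists s, extreme u s /\ supported_at j s).
    have [z zE] := a_int se; exists z => s' se' sj'.
    by rewrite -zE; exact: (nP j).
  by exists 0 => s se sj; case: nj; exists s.
have [ui uE] : in_level B n u := in_level_le (leq0n n) uB.
exists (\sum_j node j *~ (q j * ui j)) => s se.
have [j sj] := extreme_supported Gu n uB se.
have [[sB _ su] _] := se.
rewrite (eval_supported _ sB sj) mulrC mulrzA.
rewrite uE (eval_supported _ sB sj) in su.
by rewrite su; exact: qP.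
Qed.

(** Equality on extreme states extends to their convex hull because both sides
    are affine, and then to all states by density and continuity. *)
Lemma affine_represented : exists y : G, forall t, state_space R u t -> a t = t y.
Proof.
have [y yP] := integral_on_extremes; exists y => t ts.
have [tf tu] := (stateE _ _).1 ts.
apply/eqP; rewrite -subr_eq0 -normr_le0; apply/ler_addgt0Pl => e e0.
rewrite addr0; have [xs xsP] := a_local ts e0.
have [n nP] := in_common_level Gdir B [:: y, u & xs].
have [t' [t'f t'e t't]] := extreme_cone_level Gdir Gu n uB tf.
have t's : state_space R u t'.
  by apply/stateE; split=> //; rewrite t't//; apply: nP; rewrite !inE eqxx orbT.
suff at' : a t' = t' y.
  have ty : t' y = t y by apply/t't/nP; rewrite !inE eqxx.
  rewrite -ty -at' distrC; apply/ltW/xsP => // x xxs.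
  by apply/t't/nP; rewrite !inE xxs !orbT.
(* the cone over the states at which a and evaluation at y agree *)
pose D (s : G -> R) := functional s /\
  (0 < s u -> a (fun x => (s u)^-1 * s x) = (s u)^-1 * s y).
have [_] : D t'.
  apply: t'e.
  - move=> s c se c0; have [[sB s0 su] _] := se; split.
      exact: functionalZ.
    rewrite su mulr1 => cp.
    by rewrite (_ : (fun x => _) = s) ?mulKf ?gt_eqF ?yP//; apply/funext => x;
      rewrite mulKf ?gt_eqF.
  - move=> s1 s2 [f1 D1] [f2 D2]; split; first exact: functionalD.
    have [s1u|s1u] := eqVneq (s1 u) 0.
      have z := functional_unit_eq0 Gu f1 s1u.
      rewrite (_ : (fun x => _ * (s1 x + _)) = (fun x => (s2 u)^-1 * s2 x)).
        by rewrite !z !add0r.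
      by apply/funext => x; rewrite !z !add0r.
    have [s2u|s2u] := eqVneq (s2 u) 0.
      have z := functional_unit_eq0 Gu f2 s2u.
      rewrite (_ : (fun x => _ * (_ + s2 x)) = (fun x => (s1 u)^-1 * s1 x)).
        by rewrite !z !addr0.
      by apply/funext => x; rewrite !z !addr0.
    have p1 := functional_unit_gt0 Gu f1 s1u.
    have p2 := functional_unit_gt0 Gu f2 s2u.
    have p12 := addr_gt0 p1 p2 => _.
    pose c := s1 u / (s1 u + s2 u).
    have mix x : (s1 u + s2 u)^-1 * (s1 x + s2 x) =
       c * ((s1 u)^-1 * s1 x) + (1 - c) * ((s2 u)^-1 * s2 x).
      by rewrite /c; field; rewrite !gt_eqF.
    rewrite mix -D1// -D2//.
    have c01 : 0 <= c <= 1.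
      by rewrite (divr_ge0 (ltW p1) (ltW p12)) ler_pdivrMr// mul1r lerDl ltW.
    rewrite -(a_affine (state_normalize f1 p1) (state_normalize f2 p2) c01).
    by congr a; apply/funext => x; exact: mix.
  - split; last by rewrite ltxx.
    by split=> // x z; rewrite subr0.
have [_ t'u] := (stateE _ _).1 t's.
rewrite t'u ltr01 invr1 mul1r => /(_ isT) <-.
by congr a; apply/funext => x; rewrite mul1r.
Qed.

End Representation.

(** * Pointwise continuity *)

Section Pointwise.
Variable R : realType.

Lemma ptws_cvg (X : Type) (F : set_system {ptws X -> R}) (f : {ptws X -> R}) :
  Filter F -> (forall x, (fun g : {ptws X -> R} => g x) @ F --> f x) -> F --> f.
Proof.
move=> FF Ff; apply/cvg_sup => x.
rewrite cvg_image; last by rewrite eqEsubset; split=> v // _; exists (cst v).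
move=> W /Ff FW; exists (@^~ x @^-1` W) => //.
by rewrite eqEsubset; split=> [_ [g ? <-]//|v Wv]; exists (cst v).
Qed.

Lemma ptws_eval_continuous (X : eqType) (x : X) :
  continuous (fun g : {ptws X -> R} => g x).
Proof. by move=> g; exact: (@proj_continuous X (fun=> R : topologicalType) x g). Qed.

Lemma ptws_eval_mulr_continuous (X : eqType) (x : X) (c : R) :
  continuous (fun g : {ptws X -> R} => g x * c).
Proof.
move=> g; have := cvgM (@ptws_eval_continuous X x g) (cvg_cst c).
exact.
Qed.

Lemma continuous_into_ptws (T : topologicalType) (Y : Type)
    (f : T -> {ptws Y -> R}) :
  (forall y, continuous (fun t => f t y)) -> continuous f.
Proof. by move=> fy t; apply: ptws_cvg => y; exact: fy. Qed.

(** The cylinders fixing finitely many values at t generate a filter converging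
    pointwise to t. *)
Lemma within_continuous_finite (X Y : choiceType) (A : set {ptws X -> R})
    (f : {ptws X -> R} -> {ptws Y -> R}) (y : Y) :
  {within A, continuous f} -> forall t (e : R), A t -> 0 < e ->
  exists xs : seq X, forall t', A t' -> (forall x, x \in xs -> t' x = t x) ->
    `|f t' y - f t y| < e.
Proof.
move=> /subspace_continuousP fc t e At e0.
pose cyl (xs : seq X) := [set t' : {ptws X -> R} | forall x, x \in xs -> t' x = t x].
pose F := filter_from [set: seq X] cyl.
have FF : Filter F.
  apply: filter_from_filter; first by exists [::].
  move=> xs ys _ _; exists (xs ++ ys) => // t' h; split=> x xi;
    by apply: h; rewrite mem_cat xi ?orbT.
have Ft : F --> t.
  apply: ptws_cvg => x W /nbhs_singleton Wt.
  by exists [:: x] => // t' /(_ x) /=; rewrite inE eqxx => ->.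
have fty : (fun t' : {ptws X -> R} => f t' y) @ within A (nbhs t) --> f t y.
  exact: cvg_comp (fc t At) (@ptws_eval_continuous _ y (f t)).
have [xs _ xsP] : F [set t' | A t' -> `|f t' y - f t y| < e].
  apply: Ft; have /cvgrPdist_lt/(_ e e0) := fty.
  apply: filterS => t' /=.
  by rewrite distrC.
by exists xs => t' At' h; exact: xsP h At'.
Qed.

End Pointwise.

(** * Limits of non-mixing maps and rational tensor products *)

Section Presentation.
Variables (R : realType) (G : oagroup).

Definition real_oag : oagroup :=
  @OAGroup R [set x : R | 0 <= x] (lexx 0) (fun x y => @addr_ge0 _ x y).

Lemma real_oag_partially_ordered : partially_ordered real_oag.
Proof.
move=> x /= x0 nx; apply/eqP; rewrite eq_le x0 andbT.
by move: nx; rewrite /= oppr_ge0.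
Qed.

Lemma row_int_sum r (x : 'rV[int]_r) :
  x = \sum_i delta_mx 0 i *~ x 0 i.
Proof.
rewrite {1}(row_sum_delta x); apply: eq_bigr => i _.
by rewrite -scaler_int intz.
Qed.

Section Limit.
Variables (r : nat -> nat)
  (alpha : forall n, simplicial (r n) -> simplicial (r n.+1))
  (phi : forall n, simplicial (r n) -> G).
Hypothesis hlim : is_direct_limit (A := fun n => simplicial (r n)) alpha phi.
Hypothesis alpha_pos : forall n (x : simplicial (r n)), pos x -> pos (alpha x).

(** The cone generated by the images of the simplicial cones. *)
Definition image_pos : set G :=
  [set x | exists n (xi : simplicial (r n)), pos xi /\ x = phi xi].

Lemma image_pos_le n m (xi : simplicial (r n)) : (n <= m)%N -> pos xi ->
  exists2 eta : simplicial (r m), pos eta & phi xi = phi eta.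
Proof.
move=> /subnK <- xip; elim: (m - n)%N => [|k [eta etap ->]]; first by exists xi.
exists (alpha eta); first exact: alpha_pos.
by have [_ [_ ->] _] := hlim.
Qed.

Fact image_pos0 : image_pos 0.
Proof.
have [_ [phiP _] _] := hlim; exists 0%N, 0; split; first exact: pos0.
by rewrite (zmorph0 (phiP 0%N).1).
Qed.

Fact image_posD x y : image_pos x -> image_pos y -> image_pos (x + y).
Proof.
have [_ [phiP _] _] := hlim.
move=> [n [xi [xip ->]]] [m [eta [etap ->]]].
have [xi' xip' ->] := image_pos_le (leq_maxl n m) xip.
have [eta' etap' ->] := image_pos_le (leq_maxr n m) etap.
exists (maxn n m), (xi' + eta'); split; first exact: posD.
by rewrite (zmorphD (phiP _).1).
Qed.

Definition image_oag : oagroup := OAGroup image_pos0 image_posD.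

(** G with the cone [image_pos] also receives the sequence, so the universal
    property gives a positive map into it; composed with the inclusion of cones
    this map must be the identity. *)
Lemma pos_image x : pos x -> image_pos x.
Proof.
have [Gpo [phiP phiS] univ] := hlim.
have sub y : image_pos y -> pos y.
  by move=> [n [xi [xip ->]]]; exact: (phiP n).2.
have po : partially_ordered image_oag by move=> y /sub yp /sub yn; exact: Gpo.
have coc : cocone (A := fun n => simplicial (r n)) (G := image_oag) alpha phi.
  split=> // n; split; first exact: (phiP n).1.
  by move=> xi xip; exists n, xi.
have [f [[[fB fp] fphi] _]] := univ image_oag phi po coc.
have [g [_ g_unique]] := univ G phi Gpo (conj phiP phiS).
have gid : g = id by apply: g_unique; split.
have gf : g = f.
  by apply: g_unique; split=> //; split=> // y /fp; exact: sub.
by move=> /fp; rewrite -gf gid.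
Qed.

End Limit.

Lemma tree_basis_of_limit : nonmixing_dimension_group G ->
  inhabited (tree_basis R G).
Proof.
move=> [_ [r [alpha [phi [hmix hlim]]]]].
have /choice_dep[k kP] := hmix; have /choice_dep[par' parP] := kP.
have [Gpo [phiP phiS] univ] := hlim.
have alpha_pos n x : pos x -> pos (alpha n x).
  by have [k0 aE] := parP n => xp i; rewrite aE mulr_ge0 ?xp// ltW.
pose nd n (i : 'I_(r n)) : G := phi n (delta_mx 0 i).
have phiE n (x : 'rV[int]_(r n)) : phi n x = \sum_i nd n i *~ x 0 i.
  rewrite {1}(row_int_sum x) (zmorph_sum (phiP n).1); apply: eq_bigr => i _.
  by rewrite (zmorphMz (phiP n).1).
constructor; refine (@TreeBasis R G r par' k nd _ _ _ _ _).
- by move=> n j; exact: (parP n).1.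
- move=> n i; apply: (phiP n).2 => j; rewrite mxE /=.
  by case: eqP => // _; case: eqP.
- move=> n i; rewrite /nd -phiS phiE [RHS]big_mkcond; apply: eq_bigr => j _.
  rewrite (parP n).2 mxE eqxx/= eq_sym.
  by case: eqP => _; rewrite ?mulr1 ?mulr0 ?mulr0z.
- move=> x /(pos_image hlim alpha_pos) [n [xi [xip ->]]].
  by exists n, (fun i => xi 0 i); split => //; exact: phiE.
- move=> w w0 wS.
  pose psi n (x : simplicial (r n)) : real_oag :=
    \sum_i ((x : 'rV_(r n)) 0 i)%:~R * w n i.
  have coc : cocone (A := fun n => simplicial (r n)) alpha psi.
    split=> [n|n x].
      split=> [x y|x xp].
        rewrite /psi -sumrB; apply: eq_bigr => i _.
        by rewrite !mxE intrD mulrDl intrN mulNr.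
      by apply: sumr_ge0 => i _; rewrite mulr_ge0// ler0z; exact: xp.
    rewrite /psi (partition_big (par' n) predT)//=; apply: eq_bigr => i _.
    rewrite wS mulr_sumr; apply: eq_bigr => j /eqP <-.
    by rewrite (parP n).2 intrM; ring.
  have [f [[[fB fp] fphi] _]] := univ real_oag psi real_oag_partially_ordered coc.
  exists f; first by split.
  move=> n i; rewrite /nd fphi /psi (bigD1 i)//= big1 ?addr0.
    by rewrite mxE !eqxx mul1r.
  by move=> j /negbTE ji; rewrite mxE ji andbF mul0r.
Qed.

Lemma tree_basis_at_unit (u : G) : nonmixing_dimension_group G ->
  exists B : tree_basis R G, in_level B 0 u.
Proof.
move=> hG; have [B] := tree_basis_of_limit hG.
have Gdir : directed G by case: hG => -[].
have [n] := in_some_level Gdir B u.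
elim: n B => [|n IH] B uB; first by exists B.
by have [B' h] := IH (drop_root B) uB; exists B'.
Qed.

End Presentation.

Section RationalTensor.
Variable G : zmodType.

Lemma tens_zmodl (q : rat) : zmod_morphism (fun x : G => tens x q).
Proof.
move=> x y; apply: (addIr (tens y q)).
by rewrite -tensDl !subrK.
Qed.

Lemma tens_zmodr (x : G) : zmod_morphism (fun q : rat => tens x q).
Proof.
move=> p q; apply: (addIr (tens x q)).
by rewrite -tensDr !subrK.
Qed.

Lemma tens_scale (x : G) m q : (0 < m)%N -> tens (x *+ m) (q / m%:R) = tens x (q : rat).
Proof.
move=> m0; rewrite (zmorphMn (tens_zmodl _)) -(zmorphMn (tens_zmodr _)).
by rewrite -[_ *+ m]mulr_natr divfK// pnatr_eq0 -lt0n.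
Qed.

Lemma tens_int (x : G) (a : int) q : tens x (a%:~R * q) = tens (x *~ a) (q : rat).
Proof.
by rewrite (zmorphMz (tens_zmodl _)) -(zmorphMz (tens_zmodr _)) mulrzl.
Qed.

Let class (z : {freeg (G * rat)%type / int}) : tensor_group G rat :=
  (\pi_(Quotient.quot (@tensor_null G rat)) z)%qT.

Let class_zmod : zmod_morphism class.
Proof.
move=> z z'.
exact: (raddfB (\pi_(Quotient.quot (@tensor_null G rat)))%qT).
Qed.

(** Fractions can be brought to a common denominator, so sums of elementary
    tensors collapse to one. *)
Lemma tens_fraction (w : tensor_group G rat) :
  exists x n, (0 < n)%N /\ w = tens x (n%:R^-1 : rat).
Proof.
have -> : w = class (repr w) by rewrite /class reprK.
elim/freeg_ind_dom0: (repr w) => [|k [x q] D _ _ [y [m [m0 DE]]]].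
  exists 0, 1%N; split=> //.
  by rewrite (zmorph0 class_zmod) (zmorph0 (tens_zmodl _)).
have -> : class (<< k *g (x, q) >> + D) = tens x q *~ k + tens y m%:R^-1.
  rewrite (zmorphD class_zmod) DE; congr (_ + _).
  by rewrite -[in LHS](intz k) -freegU_mulz (zmorphMz class_zmod).
have [d d0 dq] : exists2 d : nat, (0 < d)%N & q = (numq q)%:~R / d%:R.
  exists `|denq q|%N; first by rewrite absz_gt0 denq_neq0.
  by rewrite pmulrn gez0_abs ?denq_ge0// divq_num_den.
exists (x *~ (numq q * k) *+ m + y *+ d), (d * m)%N; split; first by rewrite muln_gt0 d0.
rewrite natrM invfM [in RHS]tensDl tens_scale//.
rewrite [_^-1 * _]mulrC tens_scale// -(zmorphMz (tens_zmodl q)) {1}dq.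
by rewrite tens_int [(numq q * k)%R]mulrC mulrzA.
Qed.

Variable R : realType.

Lemma scalar_extension (s : G -> R) : zmod_morphism s ->
  exists2 e : tensor_group G rat -> R, zmod_morphism e &
    forall x q, e (tens x q) = s x * ratr q.
Proof.
move=> sB.
have [||e [[eB eE] _]] := @tensor_universal G rat R (fun x q => s x * ratr q).
- by move=> x y q; rewrite (zmorphD sB) mulrDl.
- by move=> x p q; rewrite raddfD mulrDr.
- by exists e.
Qed.

(** n times x (x) 1/n is x (x) 1, and the reals are torsion-free. *)
Lemma scalar_extension_unique (e e' : tensor_group G rat -> R) :
  zmod_morphism e -> zmod_morphism e' ->
  (forall x, e (tens x 1) = e' (tens x 1)) -> e =1 e'.
Proof.
move=> eB e'B ee' w; have [x [n [n0 ->]]] := tens_fraction w.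
have n0R : n%:R != 0 :> R by rewrite pnatr_eq0 -lt0n.
apply: (mulIf n0R); rewrite !mulr_natr -(zmorphMn eB) -(zmorphMn e'B).
rewrite -(zmorphMn (tens_zmodr x)) -[_ *+ n]mulr_natr mulVf ?pnatr_eq0 -?lt0n//.
Qed.

End RationalTensor.

(** * Isomorphisms and homeomorphisms *)

Lemma ratr_invn (R : realType) n : ratr (n%:R^-1) = n%:R^-1 :> R.
Proof. by rewrite fmorphV rmorph_nat. Qed.

Section Extension.
Variables (R : realType) (G : oagroup).

Definition extends (s : G -> R) (e : tensor G rat_oag -> R) :=
  zmod_morphism e /\ forall x (q : rat), e (tens x q) = s x * ratr q.

Lemma extends_exists s : zmod_morphism s -> exists e, extends s e.
Proof. by move=> /scalar_extension[e eB eE]; exists e. Qed.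

Lemma extends_ge0 s e w : functional s -> extends s e ->
  pos (w : tensor G rat_oag) -> 0 <= e w.
Proof.
move=> [_ s0] [eB eE] [l [lpos ->]]; rewrite (zmorph_sum eB).
rewrite big_seq; apply: sumr_ge0 => p /lpos[p1 p2].
by rewrite eE mulr_ge0 ?s0// ler0q.
Qed.

End Extension.

Section IsomorphismToHomeomorphism.
Variables (R : realType).

(** Writing F (x (x) 1) as y (x) 1/n turns the pullback of t into the formula
    x |-> t y / n, which makes sense for every function t; this makes continuity
    and affinity hold on the whole function space. *)
Lemma state_pullback (G H : oagroup) (u : G) (v : H)
    (F : tensor G rat_oag -> tensor H rat_oag) :
  zmod_morphism F -> (forall w, pos w -> pos (F w)) ->
  F (tens u 1) = tens v 1 ->
  exists f : {ptws H -> R} -> {ptws G -> R}, [/\ continuous f,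
    forall (t t' : H -> R) c, f (fun y => c * t y + (1 - c) * t' y) =
      (fun x => c * f t x + (1 - c) * f t' x),
    forall t, state_space R v t -> state_space R u (f t) &
    forall t e, extends t e -> forall x, f t x = e (F (tens x 1))].
Proof.
move=> FB Fpos Fu.
have /choice_dep[y /choice_dep[n ynP]] :
    forall x, exists y n, (0 < n)%N /\ F (tens x 1) = tens y (n%:R^-1 : rat).
  by move=> x; exact: tens_fraction.
pose f : {ptws H -> R} -> {ptws G -> R} := fun t x => t (y x) / (n x)%:R.
have fE t e : extends t e -> forall x, f t x = e (F (tens x 1)).
  move=> [_ eE] x; have [_ ->] := ynP x.
  by rewrite eE ratr_invn.
exists f; split=> //.
- apply: continuous_into_ptws => x t.
  exact: (@ptws_eval_mulr_continuous R H (y x) (n x)%:R^-1 t).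
- by move=> t t' c; apply/funext => x; rewrite /f; ring.
- move=> t ts; have [tf tv] := (stateE _ _).1 ts.
  have [e et] := extends_exists tf.1.
  apply/stateE; split; last by rewrite (fE t e et) Fu et.2 tv rmorph1 mulr1.
  split=> [x x'|x xp]; rewrite !(fE t e et).
    by rewrite tens_zmodl FB et.1.
  apply: (extends_ge0 tf et); apply: Fpos.
  exists [:: (x, 1)]; rewrite big_seq1; split=> // p.
  by rewrite inE => /eqP ->; split=> //=; exact: ler01.
Qed.

(** The extension of f t to the tensor product is the extension of t composed
    with F, by uniqueness of extensions. *)
Lemma pullbackK (G H : oagroup)
   (F : tensor G rat_oag -> tensor H rat_oag) F' (f : {ptws H -> R} -> {ptws G -> R})
   (f' : {ptws G -> R} -> {ptws H -> R}) (t : H -> R) :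
  zmod_morphism F -> cancel F' F -> functional t -> zmod_morphism (f t) ->
  (forall t e, extends t e -> forall x, f t x = e (F (tens x 1))) ->
  (forall s e, extends s e -> forall y, f' s y = e (F' (tens y 1))) ->
  f' (f t) = t.
Proof.
move=> FB FK [tB _] ftB fE f'E; apply/funext => y.
have [e et] := extends_exists tB; have [e' e't] := extends_exists ftB.
rewrite (f'E _ _ e't).
have -> : e' (F' (tens y 1)) = e (F (F' (tens y 1))).
  apply: (scalar_extension_unique (e := e') (e' := e \o F)).
  - exact: e't.1.
  - by move=> w w' /=; rewrite FB et.1.
  - by move=> x /=; rewrite e't.2 rmorph1 mulr1; exact: fE.
by rewrite FK et.2 rmorph1 mulr1.
Qed.

Lemma homeomorphic_of_rat_equivalent (G H : oagroup) (u : G) (v : H) :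
  rat_equivalent u v -> affinely_homeomorphic (state_space R u) (state_space R v).
Proof.
move=> [F [[F' FK F'K] FB Fpos Fu]].
have F'B : zmod_morphism F'.
  by move=> z z'; apply: (can_inj FK); rewrite FB !F'K.
have F'u : F' (tens v 1) = tens u 1 by rewrite -Fu FK.
have F'pos z : pos z -> pos (F' z) by move=> zp; apply/Fpos; rewrite F'K.
have [g [gc gaff gs gE]] := state_pullback FB (fun w => (Fpos w).1) Fu.
have [f [fc faff fs fE]] := state_pullback F'B F'pos F'u.
exists f, g; split.
- split=> // [s ss|t ts].
  + have [sf _] := (stateE u s).1 ss; have [fsf _] := (stateE v _).1 (fs s ss).
    exact: (@pullbackK H G F' F f g s F'B FK sf fsf.1 fE gE).
  + have [tf _] := (stateE v t).1 ts; have [gtf _] := (stateE u _).1 (gs t ts).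
    exact: (@pullbackK G H F F' g f t FB F'K tf gtf.1 gE fE).
- by move=> s s' c _ _ _; exact: faff.
- exact: continuous_subspaceT.
- exact: continuous_subspaceT.
Qed.

End IsomorphismToHomeomorphism.

Section HomeomorphismToIsomorphism.
Variable R : realType.

Definition affine_homeomorphism (G H : oagroup) (u : G) (v : H)
    (f : {ptws G -> R} -> {ptws H -> R}) (g : {ptws H -> R} -> {ptws G -> R}) :=
  [/\ [/\ forall s, state_space R u s -> state_space R v (f s),
          forall t, state_space R v t -> state_space R u (g t),
          forall s, state_space R u s -> g (f s) = s &
          forall t, state_space R v t -> f (g t) = t],
      forall (s s' : G -> R) (c : R), state_space R u s -> state_space R u s' ->
        0 <= c <= 1 -> f (fun x => c * s x + (1 - c) * s' x) =
        (fun y => c * f s y + (1 - c) * f s' y),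
      {within state_space R u, continuous f} &
      {within state_space R v, continuous g}].

Lemma state_convex (G : oagroup) (u : G) (s s' : G -> R) c :
  state_space R u s -> state_space R u s' -> 0 <= c <= 1 ->
  state_space R u (fun x => c * s x + (1 - c) * s' x).
Proof.
move=> /stateE[sf su] /stateE[s'f s'u] /andP[c0 c1].
apply/stateE; split; last by rewrite su s'u; ring.
by apply: functionalD; apply: functionalZ; rewrite ?subr_ge0.
Qed.

Lemma affine_homeomorphism_sym (G H : oagroup) (u : G) (v : H) f g :
  affine_homeomorphism u v f g -> affine_homeomorphism v u g f.
Proof.
move=> [[fS gS fK gK] faff fc gc]; split=> // t t' c ts t's c01.
rewrite -[RHS]fK; last exact: (state_convex (gS _ ts) (gS _ t's) c01).
by rewrite faff ?gK//; exact: gS.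
Qed.

Lemma extreme_image (G H : oagroup) (u : G) (v : H) f g s :
  affine_homeomorphism u v f g -> extreme u s -> extreme v (f s).
Proof.
move=> fg; have [[fS gS fK gK] _ _ _] := fg.
have [_ gaff _ _] := affine_homeomorphism_sym fg.
move=> [ss sext]; split; first exact: fS.
move=> t1 t2 c h1 h2 c01 fE; rewrite -(gK t1)//; congr f.
apply: (sext _ _ c (gS _ h1) (gS _ h2) c01).
rewrite -[LHS]fK// fE gaff//.
by case/andP: c01 => c0 c1; rewrite !ltW.
Qed.

(** The affine function t |-> k * g t x on S(H, v) is integral on extreme states
    for a suitable k, hence it is the evaluation at an element of H. *)
Lemma transfer_element (G H : oagroup) (u : G) (v : H) f g x
  (hG : nonmixing_dimension_group G) (hH : nonmixing_dimension_group H)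
  (hu : order_unit u) (hv : order_unit v) :
  affine_homeomorphism u v f g ->
  exists y k, (0 < k)%N /\ forall t, state_space R v t -> g t x *+ k = t y.
Proof.
move=> fg; have gf := affine_homeomorphism_sym fg.
have [BG uB] := tree_basis_at_unit R u hG.
have [BH vB] := tree_basis_at_unit R v hH.
have Gdir : directed G by case: hG => -[].
have Hdir : directed H by case: hH => -[].
have [k k0 kP] := extreme_values_commensurable Gdir hu uB x.
have [[_ gS _ _] gaff gc _] := gf.
have [] := @affine_represented R H v BH Hdir hv vB (fun t => g t x *+ k).
- by move=> t t' c ts t's c01; rewrite gaff// mulrnDl !mulrnAr.
- move=> t e ts e0.
  have ek : 0 < e / k%:R by rewrite divr_gt0 ?ltr0n.
  have [xs xsP] := within_continuous_finite x gc ts ek.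
  exists xs => t' t's h; have := xsP t' t's h.
  by rewrite -mulrnBl normrMn ltr_pdivlMr ?ltr0n// mulr_natr.
- by move=> t te; apply: kP; exact: extreme_image gf te.
- by move=> y yP; exists y, k.
Qed.

(** Clearing the denominator of w reduces this to the criterion that extreme
    states detect the positive cone of G. *)
Lemma tensor_pos_of_states (G : oagroup) (u : G) (w : tensor G rat_oag)
  (hG : nonmixing_dimension_group G) (hu : order_unit u) :
  (forall (s : G -> R) e, state_space R u s -> extends s e -> 0 <= e w) -> pos w.
Proof.
have [x [n [n0 ->]]] := tens_fraction w => h.
have [B uB] := tree_basis_at_unit R u hG.
have Gdir : directed G by case: hG => -[].
have xp : pos x.
  apply: (pos_of_extreme Gdir hu uB) => s [ss _].
  have [sB _ _] := ss; have [e es] := extends_exists sB.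
  have := h s e ss es; rewrite es.2 ratr_invn.
  by rewrite pmulr_lge0// invr_gt0 ltr0n.
exists [:: (x, n%:R^-1)]; rewrite big_seq1; split=> // p.
by rewrite inE => /eqP ->; split=> //=; rewrite invr_ge0 ler0n.
Qed.

(** By the same reduction, an element of G killed by all states is positive
    together with its opposite. *)
Lemma tensor_eq_of_states (G : oagroup) (u : G) (w w' : tensor G rat_oag)
  (hG : nonmixing_dimension_group G) (hu : order_unit u) :
  (forall (s : G -> R) e, state_space R u s -> extends s e -> e w = e w') -> w = w'.
Proof.
move=> h; apply/eqP; rewrite -subr_eq0; apply/eqP.
have {h} : forall (s : G -> R) e, state_space R u s -> extends s e -> e (w - w') = 0.
  by move=> s e ss es; rewrite es.1 (h s e)// subrr.
have [x [n [n0 ->]]] := tens_fraction (w - w') => h.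
have [B uB] := tree_basis_at_unit R u hG.
have [[Gpo _ Gdir _ _] _] := hG.
have x0 (s : G -> R) : extreme u s -> s x = 0.
  move=> [ss _]; have [sB _ _] := ss; have [e es] := extends_exists sB.
  have /eqP := h s e ss es; rewrite es.2 ratr_invn.
  by rewrite mulf_eq0 invr_eq0 pnatr_eq0 [n == _]gtn_eqF// orbF => /eqP.
suff -> : x = 0 by rewrite (zmorph0 (tens_zmodl _)).
apply: Gpo; apply: (pos_of_extreme Gdir hu uB) => s se; first by rewrite x0.
by have [[sB _ _] _] := se; rewrite (zmorphN sB) x0// oppr0.
Qed.

Section Matching.
Variables (G H : oagroup) (u : G) (v : H).
Hypotheses (hG : nonmixing_dimension_group G) (hH : nonmixing_dimension_group H)
  (hu : order_unit u) (hv : order_unit v).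

(** Equality of the affine functions that w and z induce on the two state
    spaces, identified by f. *)
Definition matches (f : {ptws G -> R} -> {ptws H -> R})
    (w : tensor G rat_oag) (z : tensor H rat_oag) :=
  forall s e e', state_space R u s -> extends s e -> extends (f s) e' ->
  e w = e' z.

Lemma match_exists f g w : affine_homeomorphism u v f g ->
  exists z, matches f w z.
Proof.
move=> fg; have [[fS gS fK gK] _ _ _] := fg.
have [x [n [n0 ->]]] := tens_fraction w.
have [y [k [k0 yP]]] := transfer_element x hG hH hu hv fg.
exists (tens y ((k * n)%:R^-1 : rat)) => s e e' ss es e's.
rewrite es.2 e's.2 -yP ?fK//; last exact: fS.
rewrite !ratr_invn natrM -[_ *+ k]mulr_natr invfM mulrA mulfK//.
by rewrite pnatr_eq0 -lt0n.
Qed.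

End Matching.

Lemma rat_equivalent_of_homeomorphic (G H : oagroup) (u : G) (v : H)
  (hG : nonmixing_dimension_group G) (hH : nonmixing_dimension_group H)
  (hu : order_unit u) (hv : order_unit v) :
  affinely_homeomorphic (state_space R u) (state_space R v) ->
  rat_equivalent u v.
Proof.
move=> [f [g fg]]; have gf := affine_homeomorphism_sym fg.
have [[fS gS fK gK] _ _ _] := fg.
have [F FP] := choice_dep (fun w => match_exists hG hH hu hv w fg).
have [F' F'P] := choice_dep (fun z => match_exists hH hG hv hu z gf).
have F'F w z : matches v g z w -> matches u f w z.
  move=> zw s e e' ss es e's; apply/esym.
  by apply: (zw (f s) e' e (fS s ss) e's); rewrite fK.
have extf s : state_space R u s -> exists e, extends (f s) e.
  by move=> /fS [sB _ _]; exact: extends_exists.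
have extg t : state_space R v t -> exists e, extends (g t) e.
  by move=> /gS [sB _ _]; exact: extends_exists.
have FE t e e' w : state_space R v t -> extends t e -> extends (g t) e' ->
    e (F w) = e' w.
  move=> ts et e't; apply/esym; apply: (FP w (g t)) => //; first exact: gS.
  by rewrite gK.
have FK : cancel F F'.
  move=> w; apply: (tensor_eq_of_states hG hu) => s e ss es.
  have [e' e's] := extf s ss.
  by rewrite (F'F _ _ (F'P (F w)) s e e')// (FP w s e e').
have F'K : cancel F' F.
  move=> z; apply: (tensor_eq_of_states hH hv) => t e ts et.
  have [e' e't] := extg t ts.
  by rewrite (FE t e e')// (F'P z t e e').
exists F; split.
- by exists F'.
- move=> w w'; apply: (tensor_eq_of_states hH hv) => t e ts et.
  have [e' e't] := extg t ts.
  by rewrite et.1 !(FE t e e')// e't.1.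
- move=> w; split=> wp.
    apply: (tensor_pos_of_states hH hv) => t e ts et.
    have [e' e't] := extg t ts; rewrite (FE t e e')//.
    by apply: extends_ge0 e't wp; have /stateE[] := gS t ts.
  apply: (tensor_pos_of_states hG hu) => s e ss es.
  have [e' e's] := extf s ss; rewrite (FP w s e e')//.
  by apply: extends_ge0 e's wp; have /stateE[] := fS s ss.
- apply: (tensor_eq_of_states hH hv) => t e ts et.
  have [e' e't] := extg t ts; rewrite (FE t e e')// et.2 e't.2.
  by have [_ _ ->] := ts; have [_ _ ->] := gS t ts.
Qed.

End HomeomorphismToIsomorphism.

Theorem theorem2p7 (R : realType) (G H : oagroup) (u : G) (v : H)
    (hG : nonmixing_dimension_group G) (hH : nonmixing_dimension_group H)
    (hu : order_unit u) (hv : order_unit v) :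
  affinely_homeomorphic (state_space R u) (state_space R v) <->
  rat_equivalent u v.
Proof.
split; first exact: rat_equivalent_of_homeomorphic.
exact: homeomorphic_of_rat_equivalent.
Qed.
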